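(* Let $\mathcal{H},\mathcal{K}$ be Hilbert spaces and let the linear operators $S$ (acting between $\mathcal{H}$ and $\mathcal{K}$) and $T$ (acting between $\mathcal{K}$ and $\mathcal{H}$) satisfy $$\overline{G\Bigl(\tfrac1\lambda S\Bigr)}\oplus F_{\mathcal{K},\mathcal{H}}\overline{G\Bigl(\tfrac1\lambda T\Bigr)}=\mathcal{H}\times\mathcal{K}\qquad( * )$$ for a certain given $\lambda\in\mathbb{R}$, $\lambda\neq0$. Then the following two statements are equivalent: (i) $S$ is closable; (ii) $T$ is densely defined. If either of the conditions (i) or (ii) is satisfied, then the equality $\bar S=T^*$ holds true. Conversely, if $S$ (between $\mathcal{H}$ and $\mathcal{K}$) is closable, $T$ (between $\mathcal{K}$ and $\mathcal{H}$) is densely defined and $\bar S=T^*$, then $( * )$ holds true for every $\lambda\in\mathbb{R}$, $\lambda\neq0$.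
   Context: Hilbert spaces are over the same scalar field, $\mathbb{R}$ or $\mathbb{C}$. A linear operator $S$ acting between $\mathcal{H}$ and $\mathcal{K}$ is a linear map $S:\operatorname{dom}S\to\mathcal{K}$ defined on a linear subspace $\operatorname{dom}S\subseteq\mathcal{H}$; it is not assumed bounded, closed or densely defined unless stated. Its graph is $G(S)=\{(h,Sh):h\in\operatorname{dom}S\}\subseteq\mathcal{H}\times\mathcal{K}$. $S$ is closable if $\overline{G(S)}$ is the graph of an operator, which is then denoted $\bar S$. The flip operator $F_{\mathcal{K},\mathcal{H}}:\mathcal{K}\times\mathcal{H}\to\mathcal{H}\times\mathcal{K}$ is $F_{\mathcal{K},\mathcal{H}}(k,h)=(h,-k)$. The symbol $\oplus$ denotes an orthogonal sum: $A\oplus B=X$ means that the subspaces $A,B$ are orthogonal to each other and $A+B=X$. The adjoint $T^*$ of a densely defined $T$ has domain $\{h\in\mathcal{H}:\exists k'\in\mathcal{K}\ \forall k\in\operatorname{dom}T,\ \langle Tk,h\rangle=\langle k,k'\rangle\}$ and $T^*h:=k'$. Equality of operators includes equality of domains. *)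

(* Defs.v *)
From HB Require Import structures.
From mathcomp Require Import all_boot all_order all_algebra.
From mathcomp Require Import complex.
From mathcomp Require Import all_classical all_reals all_analysis.

Set Implicit Arguments.
Unset Strict Implicit.
Unset Printing Implicit Defensive.

Import Order.TTheory GRing.Theory Num.Theory.
Import numFieldNormedType.Exports.

Local Open Scope classical_set_scope.
Local Open Scope ring_scope.

Variant scalar_kind := RealScalars | ComplexScalars.

Definition scalar (R : realType) (k : scalar_kind) : numFieldType :=
  match k with
  | RealScalars => R
  | ComplexScalars => R[i]
  end.

Definition scalar_conj (R : realType) (k : scalar_kind) :
    scalar R k -> scalar R k :=
  match k with
  | RealScalars => fun x => x
  | ComplexScalars => fun z => z^*%R
  end.

Definition scalar_of_real (R : realType) (k : scalar_kind) :
    R -> scalar R k :=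
  match k with
  | RealScalars => fun x => x
  | ComplexScalars => fun x => x%:C%C
  end.

Fact scalar_conj_zmod_morphism (R : realType) (k : scalar_kind) :
  zmod_morphism (@scalar_conj R k).
Proof. by case: k => //= x y; rewrite rmorphB. Qed.

Fact scalar_conj_monoid_morphism (R : realType) (k : scalar_kind) :
  monoid_morphism (@scalar_conj R k).
Proof. by case: k => //=; split=> [|x y]; rewrite (rmorph1, rmorphM). Qed.

Fact scalar_conjK (R : realType) (k : scalar_kind) :
  involutive (@scalar_conj R k).
Proof. by case: k => //= x; rewrite conjCK. Qed.

HB.instance Definition _ (R : realType) (k : scalar_kind) :=
  GRing.isZmodMorphism.Build _ _ _ (@scalar_conj_zmod_morphism R k).
HB.instance Definition _ (R : realType) (k : scalar_kind) :=
  GRing.isMonoidMorphism.Build _ _ _ (@scalar_conj_monoid_morphism R k).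
HB.instance Definition _ (R : realType) (k : scalar_kind) :=
  isInvolutive.Build _ _ (@scalar_conjK R k).

(* [inner] is linear in its first argument and conjugate-linear in the second.
   Norms take their values in the scalar field, as nonnegative reals. *)
HB.mixin Record CompleteNormedModule_isHilbert (R : realType) (k : scalar_kind)
    H of CompleteNormedModule (scalar R k) H := {
  inner : {dot H for @scalar_conj R k} ;
  sqr_norm_inner : forall x : H, `|x| ^+ 2 = inner x x }.

#[short(type="hilbertType")]
HB.structure Definition Hilbert (R : realType) (k : scalar_kind) :=
  { H of CompleteNormedModule (scalar R k) H &
         CompleteNormedModule_isHilbert R k H }.

(* A linear operator defined on a subspace of V.  The value of the underlying
   function outside of the domain is irrelevant: see [op_eq]. *)
Record operator (F : numFieldType) (V W : lmodType F) := Operator {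
  dom : set V ;
  op_fun :> V -> W ;
  dom0 : dom 0 ;
  dom_linear : forall a x y, dom x -> dom y -> dom (a *: x + y) ;
  op_linear : forall a x y, dom x -> dom y ->
    op_fun (a *: x + y) = a *: op_fun x + op_fun y }.

Section Operators.
Variables (F : numFieldType) (V W : lmodType F).
Implicit Types S : operator V W.

Definition op_eq S1 S2 :=
  dom S1 = dom S2 /\ (forall x, dom S1 x -> S1 x = S2 x).

Definition graph S : set (V * W) := [set (x, S x) | x in dom S].

Fact scale_op_linear (c : F) S a x y : dom S x -> dom S y ->
  c *: S (a *: x + y) = a *: (c *: S x) + c *: S y.
Proof.
by move=> Sx Sy; rewrite op_linear // scalerDr !scalerA [c * a]mulrC.
Qed.

Definition scale_op (c : F) S : operator V W :=
  @Operator F V W (dom S) (fun x => c *: S x) (@dom0 _ _ _ S)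
    (@dom_linear _ _ _ S) (scale_op_linear c (S := S)).

End Operators.

Definition flip (F : numFieldType) (V W : lmodType F) (x : W * V) : V * W :=
  (x.2, - x.1).

Section Closure.
Variables (F : numFieldType) (V W : normedModType F).
Implicit Types S : operator V W.

(* [closure] is taken in the product topology, which is the topology of the
   Hilbert norm on V * W when V and W are Hilbert spaces. *)
Definition closable S :=
  exists B : operator V W, graph B = closure (graph S).

Definition densely_defined S := dense (dom S).

Definition op_closure S (cS : closable S) : operator V W :=
  projT1 (cid cS).

Fact graph_op_closure S (cS : closable S) :
  graph (op_closure cS) = closure (graph S).
Proof. by rewrite /op_closure; case: cid. Qed.

End Closure.

Section Adjoint.
Variables (R : realType) (k : scalar_kind) (H K : hilbertType R k).

Definition adjoint_rel (T : operator K H) (h : H) (k' : K) :=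
  forall x, dom T x -> inner (T x) h = inner x k'.

Definition adjoint_dom (T : operator K H) : set H :=
  [set h | exists k', adjoint_rel T h k'].

(* The vector k' is unique as soon as T is densely defined: see
   [adjoint_rel_unique]. *)
Definition adjoint_fun (T : operator K H) (h : H) : K :=
  xget 0 [set k' | adjoint_rel T h k'].

Fact adjoint_funP (T : operator K H) h :
  adjoint_dom T h -> adjoint_rel T h (adjoint_fun T h).
Proof. by move=> [k' Tk']; apply: (xgetPex 0); exists k'. Qed.

Fact adjoint_rel_linear (T : operator K H) a h1 h2 k1 k2 :
  adjoint_rel T h1 k1 -> adjoint_rel T h2 k2 ->
  adjoint_rel T (a *: h1 + h2) (a *: k1 + k2).
Proof.
by move=> T1 T2 x Tx; rewrite !linearP /= T1 // T2.
Qed.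

Fact dense_orthogonal_eq0 (D : set K) (u : K) :
  dense D -> (forall x, D x -> inner x u = 0) -> u = 0.
Proof.
move=> dD Du; apply/eqP/negPn/negP => u0.
have nu0 : 0 < `|u| by rewrite normr_gt0.
have [x []] : ball u `|u| `&` D !=set0.
  by apply: dD; [exists u; exact: ballxx | exact: ball_open].
rewrite -ball_normE /= => ux Dx.
have uxN : inner u x = 0.
  by rewrite hermC /= expr0 mul1r Du // rmorph0.
have : `|u - x| ^+ 2 < `|u| ^+ 2 by rewrite ltrXn2r.
rewrite [ltLHS]sqr_norm_inner hnormBd //.
have -> : inner u u + inner x x = `|u| ^+ 2 + `|x| ^+ 2.
  by rewrite !sqr_norm_inner.
by rewrite gtrDl le_gtF // exprn_ge0.
Qed.

Fact adjoint_rel_unique (T : operator K H) h k1 k2 : densely_defined T ->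
  adjoint_rel T h k1 -> adjoint_rel T h k2 -> k1 = k2.
Proof.
move=> dT T1 T2; apply/eqP; rewrite -subr_eq0; apply/eqP.
apply: (dense_orthogonal_eq0 dT) => x Tx.
by rewrite linearB /= -T1 // -T2 // subrr.
Qed.

Fact adjoint_dom0 (T : operator K H) : adjoint_dom T 0.
Proof. by exists 0 => x Tx; rewrite !linear0. Qed.

Fact adjoint_dom_linear (T : operator K H) a h1 h2 :
  adjoint_dom T h1 -> adjoint_dom T h2 -> adjoint_dom T (a *: h1 + h2).
Proof.
move=> [k1 T1] [k2 T2]; exists (a *: k1 + k2).
exact: adjoint_rel_linear.
Qed.

Fact adjoint_fun_linear (T : operator K H) (dT : densely_defined T) a h1 h2 :
  adjoint_dom T h1 -> adjoint_dom T h2 ->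
  adjoint_fun T (a *: h1 + h2) = a *: adjoint_fun T h1 + adjoint_fun T h2.
Proof.
move=> T1 T2; apply: (adjoint_rel_unique (h := a *: h1 + h2) dT).
  by apply: adjoint_funP; exact: adjoint_dom_linear.
by apply: adjoint_rel_linear; exact: adjoint_funP.
Qed.

Definition adjoint (T : operator K H) (dT : densely_defined T) :
    operator H K :=
  Operator (adjoint_dom0 T) (adjoint_dom_linear (T := T))
    (adjoint_fun_linear dT).

End Adjoint.

Section OrthogonalSum.
Variables (R : realType) (k : scalar_kind) (H K : hilbertType R k).

(* The inner product of the Hilbert space H * K.  The library already equips
   the product type with the (equivalent) maximum norm, so H * K is not itself
   declared to be a [hilbertType]. *)
Definition prod_inner (x y : H * K) : scalar R k :=
  inner x.1 y.1 + inner x.2 y.2.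

Definition is_orthogonal_sum (A B X : set (H * K)) :=
  (forall a b, A a -> B b -> prod_inner a b = 0) /\
  [set a + b | a in A & b in B] = X.

End OrthogonalSum.

Definition graph_decomposition (R : realType) (k : scalar_kind)
    (H K : hilbertType R k) (S : operator H K) (T : operator K H) (lam : R) :=
  let c := scalar_of_real k (1 / lam) in
  is_orthogonal_sum (closure (graph (scale_op c S)))
    (@flip _ H K @` closure (graph (scale_op c T))) setT.

(* Main.v *)
Require Import Defs.
From HB Require Import structures.
From mathcomp Require Import all_boot all_order all_algebra.
From mathcomp Require Import complex ring.
From mathcomp Require Import all_classical all_reals all_analysis.

Set Implicit Arguments.
Unset Strict Implicit.
Unset Printing Implicit Defensive.

Import Order.TTheory GRing.Theory Num.Theory.
Import numFieldNormedType.Exports.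

Local Open Scope classical_set_scope.
Local Open Scope ring_scope.

(** Write [D^perp] for the orthogonal complement.  If [B] is a closed subspace
    of a Hilbert space, the projection theorem says that the only set [A] with
    [A (+) B] the whole space is [B^perp].  Apply this to [B], the flipped
    closure of the graph of [T / lam]; its orthogonal complement is already
    that of the flipped graph, and unfolding [(h, u) _|_ (T x / lam, - x)]
    for [x] in [dom T] gives, after the rescaling [u = u' / lam],
    [<T x, h> = <x, u'>].  So the decomposition says, for every nonzero [lam]
    alike, that the closure of the graph of [S] is the set of pairs [(h, u')]
    for which [u'] may serve as the value at [h] of an adjoint of [T]
    ([graph_decompositionP]).

    Everything follows from this description.  When [T] is densely defined that
    set is the graph of [T^*]; this gives the closability of [S], the equality
    of its closure with [T^*], and also the converse part of the theorem.  When
    [S] is closable, that set is the graph of an operator, so it contains no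
    [(0, u)] with [u != 0]; but [(0, u)] belongs to it as soon as [u] is
    orthogonal to [dom T].  Hence [dom T] has zero orthogonal complement, and
    is dense by the projection theorem.

    The projection theorem ([orthogonal_projection]) is proved for a positive
    form on a complete space whose norm is equivalent to the one given by the
    form, and not equal to it: this covers both a Hilbert space and a product
    of two of them with the maximum norm. *)

(** * The scalars *)

Section Scalars.
Variables (R : realType) (k : scalar_kind).
Local Notation F := (Defs.scalar R k).

Lemma mulr_scalar_conj (x : F) : x * scalar_conj x = `|x| ^+ 2.
Proof.
case: k x => /= x; last by rewrite normCK.
by rewrite -expr2 real_normK ?num_real.
Qed.

Lemma scalar_conj_of_real (r : R) :
  scalar_conj (scalar_of_real k r) = scalar_of_real k r.
Proof. by case: k => //=; rewrite conj_Creal ?complex_real. Qed.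

Lemma scalar_of_real_neq0 (r : R) : r != 0 -> scalar_of_real k r != 0.
Proof. by case: k => //= r0; rewrite fmorph_eq0. Qed.

(** The scalars are only partially ordered in the complex case, but
    nonnegative ones are real, which is all that minimizing a squared distance
    requires. *)
Lemma scalar_inf (A : set F) : A !=set0 -> (forall a, A a -> 0 <= a) ->
  exists d, (forall a, A a -> d <= a) /\
            (forall e, 0 < e -> exists2 a, A a & a < d + e).
Proof.
have realP (B : set R) : B !=set0 -> (forall a, B a -> 0 <= a) ->
  exists d, (forall a, B a -> d <= a) /\
            (forall e, 0 < e -> exists2 a, B a & a < d + e).
  move=> B0 Bge0; have hB : has_inf B by split=> //; exists 0.
  exists (inf B); split=> [a Ba | e e0]; last exact: inf_adherent.
  by apply: ge_inf => //; case: hB.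
case: k A => //= A [a0 Aa0] Age0.
have [||d [dA Ad]] := realP [set complex.Re a | a in A].
- by exists (complex.Re a0), a0.
- by move=> _ [a /Age0 + <-]; rewrite lecE => /andP[].
exists d%:C%C; split=> [a Aa | e e0].
  have := Age0 _ Aa; rewrite !lecE /= => /andP[-> _] /=.
  by apply: dA; exists a.
move: e0; rewrite ltcE /= => /andP[/eqP Ime Ree0].
have [_ [a Aa <-] ade] := Ad _ Ree0; exists a => //.
have := Age0 _ Aa; rewrite lecE ltcE /= => /andP[/eqP -> _].
by case: e Ime {Ree0} ade => [er ei] /= -> ->; rewrite addr0 eqxx.
Qed.

End Scalars.

(** * Positive forms *)

Definition orthocomp (F : numFieldType) (E : lmodType F) (f : E -> E -> F)
  (D : set E) : set E := [set u | forall x, D x -> f u x = 0].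

Definition subspace_set (F : numFieldType) (E : lmodType F) (D : set E) :=
  D 0 /\ (forall a x y, D x -> D y -> D (a *: x + y)).

Section DotAlgebra.
Variables (R : realType) (k : scalar_kind).
Local Notation F := (Defs.scalar R k).
Variables (E : lmodType F) (f : {dot E for @scalar_conj R k}).
Implicit Types u v x y z : E.

Lemma dotC u v : f u v = scalar_conj (f v u).
Proof. by rewrite hermC expr0 mul1r. Qed.

Lemma dot_eq0C u v : f u v = 0 -> f v u = 0.
Proof. by move=> uv; rewrite dotC uv rmorph0. Qed.

Lemma dot_ge0 u : 0 <= f u u.
Proof.
have [->|u0] := eqVneq u 0; first by rewrite linear0.
by rewrite ltW // neq0_dnorm_gt0.
Qed.

Lemma dot_eq0 u : f u u = 0 -> u = 0.
Proof.
move=> fu; apply/eqP/negPn/negP => u0.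
by have := neq0_dnorm_gt0 (s := f) _ u0; rewrite fu ltxx.
Qed.

Lemma dot_parallelogram x y : f (x - y) (x - y) + f (x + y) (x + y) =
  (f x x + f y y) *+ 2.
Proof. by rewrite hnormB hnormD /=; ring. Qed.

(** Subtracting from [u] its component along [v] lowers the square of its norm
    by [`|f u v| ^+ 2 / f v v].  The nonnegativity of the result is the
    Cauchy-Schwarz inequality; its lower bound in a minimization problem is what
    makes a minimizer orthogonal to [v]. *)
Lemma dot_sub_proj u v : v != 0 ->
  let w := u - (f u v / f v v) *: v in
  f w w = f u u - `|f u v| ^+ 2 / f v v.
Proof.
move=> v0; set t := f u v / f v v => /=.
have fv : f v v != 0 by rewrite gt_eqF // neq0_dnorm_gt0.
have wv : f (u - t *: v) v = 0.
  by rewrite linearBl linearZl_LR /= /t mulfVK // subrr.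
rewrite [in LHS]linearBr /= linearZr_LR /= wv mulr0 subr0.
rewrite linearBl /= linearZl_LR /= [f v u]dotC /t mulrAC mulr_scalar_conj.
by [].
Qed.

Lemma dot_Cauchy_Schwarz u v : `|f u v| ^+ 2 <= f u u * f v v.
Proof.
have [->|v0] := eqVneq v 0; first by rewrite !linear0 normr0 mulr0 expr0n.
rewrite -ler_pdivrMr ?neq0_dnorm_gt0 // -subr_ge0 -dot_sub_proj //.
exact: dot_ge0.
Qed.

End DotAlgebra.

Section DotTopology.
Variables (R : realType) (k : scalar_kind).
Local Notation F := (Defs.scalar R k).
Variables (E : normedModType F) (f : {dot E for @scalar_conj R k}) (C : F).
Hypothesis f_le : forall x, f x x <= C * `|x| ^+ 2.
Implicit Types u v x y z : E.

(** By Cauchy-Schwarz, [`|f (u - x) v| ^+ 2 <= C * f v v * `|u - x| ^+ 2]. *)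
Lemma continuous_dotl v : continuous (f ^~ v : E -> F).
Proof.
move=> u; apply/cvgrPdist_lt => e e0.
have [v0|v0] := eqVneq v 0.
  by near=> x; rewrite v0 !linear0 addr0 normr0.
have fv : 0 < f v v by exact: neq0_dnorm_gt0.
have C0 : 0 < C.
  have nv : 0 < `|v| ^+ 2 by rewrite exprn_gt0 // normr_gt0.
  by rewrite -(pmulr_lgt0 _ nv) (lt_le_trans fv).
pose a := C * f v v; have a0 : 0 < a by rewrite mulr_gt0.
have a1 : 0 < 1 + a by rewrite addr_gt0.
near=> x.
rewrite -linearBl /= -(@ltr_pXn2r _ 2) ?nnegrE ?(ltW e0) ?normr_ge0 //.
apply: (le_lt_trans (dot_Cauchy_Schwarz f (u - x) v)).
apply: (@le_lt_trans _ _ (a * `|u - x| ^+ 2)).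
  by rewrite /a mulrAC ler_pM2r.
rewrite -ltr_pdivlMl // mulrC.
(* The radius e / (1 + a) works because a < (1 + a) ^+ 2. *)
apply: (@lt_trans _ _ ((e / (1 + a)) ^+ 2)).
  rewrite ltr_pXn2r ?nnegrE ?normr_ge0 ?divr_ge0 ?ltW //.
  by near: x; apply: (cvgr_dist_lt id u cvg_id); rewrite divr_gt0.
rewrite expr_div_n ltr_pM2l ?exprn_gt0 // ltf_pV2 ?posrE ?exprn_gt0 //.
rewrite sqrrD expr1n mul1r mulr2n -!addrA ltr_wpDl //.
by rewrite ltrDl addr_gt0 ?exprn_gt0.
Unshelve. all: by end_near.
Qed.

Lemma closed_orthocomp (D : set E) : closed (orthocomp f D).
Proof.
rewrite (_ : orthocomp f D = \bigcap_(x in D) [set u | f u x = 0]); last first.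
  by apply/seteqP; split.
apply: closed_bigI => x _.
apply: (@preimage_closed _ _ (f ^~ x) [set 0]) => [u _|].
  exact: continuous_dotl.
apply: accessible_closed_set1; apply: hausdorff_accessible.
exact: norm_hausdorff.
Qed.

Lemma orthocomp_closure (D : set E) : orthocomp f (closure D) = orthocomp f D.
Proof.
apply/seteqP; split=> u uD x; first by move=> Dx; apply/uD/subset_closure.
move=> Dx; apply: dot_eq0C.
have : closed (orthocomp f [set u]) by exact: closed_orthocomp.
rewrite closure_id => cl.
have : orthocomp f [set u] x.
  rewrite cl; apply: closureS Dx => y /uD uy _ ->.
  exact: dot_eq0C.
by move=> /(_ u erefl).
Qed.

End DotTopology.

(** * The projection theorem *)

(** A predicate rather than a structure, so that it can be derived for the
    maximum norm on a product without adding a structure to the product type. *)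
Definition complete_uniform (T : uniformType) :=
  forall G : set_system T, ProperFilter G -> cauchy G -> exists p : T, G --> p.

Lemma completeType_complete (T : completeType) : complete_uniform T.
Proof. by move=> G FG /cauchy_cvg/cvg_ex. Qed.

Lemma complete_uniform_prod (T U : uniformType) :
  complete_uniform T -> complete_uniform U -> complete_uniform (T * U)%type.
Proof.
move=> Tc Uc G FG cG.
have [p Gp] : exists p : T, fst @ G --> p.
  apply: Tc => A eA.
  have [[P Q] /= [GP GQ] PQ] := cG _ (prod_entP eA entourageT).
  exists (fst @` P, fst @` Q) => /=.
    by split; [move: GP | move: GQ]; apply: filterS => x Px /=; exists x.
  move=> [_ _] [/= [x Px <-] [y Qy <-]].
  by have [] := PQ (x, y) (conj Px Qy).
have [q Gq] : exists q : U, snd @ G --> q.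
  apply: Uc => A eA.
  have [[P Q] /= [GP GQ] PQ] := cG _ (prod_entP entourageT eA).
  exists (snd @` P, snd @` Q) => /=.
    by split; [move: GP | move: GQ]; apply: filterS => x Px /=; exists x.
  move=> [_ _] [/= [x Px <-] [y Qy <-]].
  by have [] := PQ (x, y) (conj Px Qy).
exists (p, q) => A Apq.
have : G ((fun x => (x.1, x.2)) @^-1` A) by exact: (cvg_pair Gp Gq Apq).
by apply: filterS => -[].
Qed.

Section Projection.
Variables (R : realType) (k : scalar_kind).
Local Notation F := (Defs.scalar R k).
Variables (E : normedModType F) (f : {dot E for @scalar_conj R k}) (C : F).
Hypothesis E_complete : complete_uniform E.
Hypothesis f_ge : forall x, `|x| ^+ 2 <= f x x.
Hypothesis f_le : forall x, f x x <= C * `|x| ^+ 2.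
Implicit Types (D : set E) (u v x y z : E).

(** Parallelogram identity for [z - x] and [z - y]: the half-sum of these two
    vectors is [z - (x + y) / 2], whose square is at least [d]. *)
Lemma near_minimizers D z (d e : F) x y : subspace_set D ->
  (forall u, D u -> d <= f (z - u) (z - u)) -> D x -> D y ->
  f (z - x) (z - x) < d + e -> f (z - y) (z - y) < d + e ->
  f (x - y) (x - y) < e *+ 4.
Proof.
move=> [D0 Dlin] dmin Dx Dy fx fy.
pose w := 2^-1 *: (x + y).
have Dw : D w.
  rewrite -[w]addr0; apply: (Dlin _ _ _ _ D0).
  by rewrite -[x]scale1r; apply: Dlin.
have -> : x - y = (z - y) - (z - x) by rewrite opprB [RHS]addrC addrA subrK.
have : f ((z - y) + (z - x)) ((z - y) + (z - x)) = f (z - w) (z - w) *+ 4.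
  have -> : (z - y) + (z - x) = (2 : F) *: (z - w).
    rewrite scalerBr /w scalerA mulfV ?pnatr_eq0 // scale1r.
    by rewrite scaler_nat mulr2n opprD addrACA [- y - x]addrC.
  rewrite linearZl_LR linearZr_LR /= rmorph_nat mulrA -natrM mulr_natl //.
move=> fw; have := dot_parallelogram f (z - y) (z - x).
rewrite fw => /(canRL (addrK _)) ->.
have -> : e *+ 4 = ((d + e) + (d + e)) *+ 2 - d *+ 4 by ring.
by rewrite ltr_leD ?lerN2 ?lerMn2r ?dmin ?orbT // ltrMn2r /= ltrD.
Qed.

(** The approximate minimizers in [D] of the distance to [z] form a Cauchy
    filter, whose limit is [p].  For [y] in [D], moving an approximate minimizer
    [x] along [y] cannot gain more than its defect, so that [f (z - x) y] is
    small; it tends to [f (z - p) y], which must vanish. *)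
Lemma orthogonal_projection D z : subspace_set D ->
  exists2 p, closure D p & orthocomp f D (z - p).
Proof.
move=> sD; have [D0 Dlin] := sD.
have [||d [dmin dadh]] := @scalar_inf R k [set f (z - x) (z - x) | x in D].
- by exists (f (z - 0) (z - 0)), 0.
- by move=> _ [x _ <-]; exact: dot_ge0.
have {}dmin u : D u -> d <= f (z - u) (z - u).
  by move=> Du; apply: dmin; exists u.
pose B (e : F) := [set x | D x /\ f (z - x) (z - x) < d + e].
pose G := filter_from [set e : F | 0 < e] B.
have Bex e : 0 < e -> exists x, B e x.
  by move=> /dadh[_ [x Dx <-] fx]; exists x.
have FG : ProperFilter G.
  apply: filter_from_proper => //; apply: filter_from_filter.
    by exists 1; exact: ltr01.
  move=> i j /= i0 j0.
  have /orP[ij|ji] : (i <= j) || (j <= i) by rewrite real_leVge ?gtr0_real.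
    exists i => // x [Dx fx]; split; split=> //.
    by rewrite (lt_le_trans fx) // lerD2l.
  exists j => // x [Dx fx]; split; split=> //.
  by rewrite (lt_le_trans fx) // lerD2l.
have [|p Gp] := E_complete FG.
  apply: cauchy_exP => e e0.
  have e4 : 0 < e ^+ 2 / 4 by rewrite divr_gt0 ?exprn_gt0.
  have [x [Dx fx]] := Bex _ e4; exists x.
  exists (e ^+ 2 / 4) => //= y [Dy fy].
  rewrite -ball_normE /ball_ /= -(@ltr_pXn2r _ 2) ?nnegrE ?(ltW e0) //.
  apply: (le_lt_trans (f_ge _)).
  have := near_minimizers sD dmin Dx Dy fx fy.
  by rewrite -[(_ / _) *+ 4]mulr_natr divfK ?pnatr_eq0.
exists p => [|y Dy].
  move=> U /Gp GU; apply: (@filter_ex _ G); apply: filterI => //.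
  by exists 1; [exact: ltr01 | move=> x []].
have [->|y0] := eqVneq y 0; first by rewrite linear0.
have fy : 0 < f y y by exact: neq0_dnorm_gt0.
have cvp : f (z - x) y @[x --> G] --> f (z - p) y.
  apply: (cvg_comp (fun x => z - x) (f ^~ y)).
    by apply: cvgB Gp; exact: cvg_cst.
  exact: (continuous_dotl f_le).
have cv0 : f (z - x) y @[x --> G] --> (0 : F).
  apply/cvgr0Pnorm_lt => e e0.
  exists (e ^+ 2 / f y y); first by rewrite /= divr_gt0 ?exprn_gt0.
  move=> x [Dx fx] /=.
  rewrite -(@ltr_pXn2r _ 2) ?nnegrE ?(ltW e0) //.
  have := dmin _ (Dlin (f (z - x) y / f y y) _ _ Dy Dx).
  rewrite [_ + x]addrC opprD addrA dot_sub_proj //.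
  rewrite lerBrDr => /le_lt_trans /(_ fx).
  by rewrite ltrD2l ltr_pM2r ?invr_gt0.
exact: (cvg_unique (@norm_hausdorff _ F) cvp cv0).
Qed.

End Projection.

(** The remainder of the projection on the closure of [D] is orthogonal to
    [D]. *)
Lemma subspace_dense (R : realType) (k : scalar_kind) (K : hilbertType R k)
    (D : set K) :
  subspace_set D -> (forall u : K, (forall x, D x -> inner x u = 0) -> u = 0) ->
  dense D.
Proof.
move=> sD D0 O [z Oz] oO.
have ge (x : K) : `|x| ^+ 2 <= inner x x by rewrite sqr_norm_inner.
have le (x : K) : inner x x <= 1 * `|x| ^+ 2 by rewrite mul1r sqr_norm_inner.
have [p Dp zp] := orthogonal_projection (@completeType_complete K) ge le z sD.
have /D0/eqP : forall x, D x -> inner x (z - p) = 0.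
  by move=> x /zp; exact: dot_eq0C.
rewrite subr_eq0 => /eqP zE; rewrite setIC; apply: Dp.
by rewrite -zE; exact: open_nbhs_nbhs.
Qed.

(** * Orthogonal sums in the product of two Hilbert spaces *)

Section ProdInner.
Variables (R : realType) (k : scalar_kind) (H K : hilbertType R k).
Local Notation F := (Defs.scalar R k).
Local Notation prod_inner := (@prod_inner R k H K).

Fact prod_inner_bilinear :
  bilinear_for ( *%R : GRing.Scale.law F F) (@scalar_conj R k \; *%R)
    prod_inner.
Proof.
split=> u a x y; rewrite /Defs.prod_inner /=.
  by rewrite !linearPl /=; ring.
by rewrite !linearPr /=; ring.
Qed.

HB.instance Definition _ := bilinear_isBilinear.Build F
  (H * K)%type (H * K)%type F ( *%R) (@scalar_conj R k \; *%R)
  prod_inner prod_inner_bilinear.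

Fact prod_inner_hermitian x y :
  prod_inner x y = (-1) ^+ false * scalar_conj (prod_inner y x).
Proof.
by rewrite expr0 mul1r /Defs.prod_inner rmorphD /= -!dotC.
Qed.

HB.instance Definition _ := isHermitianSesquilinear.Build F (H * K)%type false
  (@scalar_conj R k) prod_inner prod_inner_hermitian.

Fact prod_inner_gt0 x : x != 0 -> 0 < prod_inner x x.
Proof.
case: x => h u; rewrite /Defs.prod_inner /= => hu.
rewrite lt_neqAle addr_ge0 ?dot_ge0 // andbT eq_sym.
apply: contra hu; rewrite paddr_eq0 ?dot_ge0 // => /andP[/eqP h0 /eqP u0].
by rewrite (dot_eq0 h0) (dot_eq0 u0).
Qed.

HB.instance Definition _ := isDotProduct.Build F (H * K)%type prod_inner
  prod_inner_gt0.

Definition prod_dot : {dot (H * K)%type for @scalar_conj R k} := prod_inner.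

Lemma prod_dot_ge x : `|x| ^+ 2 <= prod_dot x x.
Proof.
rewrite /prod_dot /= /Defs.prod_inner -!sqr_norm_inner prod_normE /=.
have /orP[] : (`|x.1| <= `|x.2|) || (`|x.2| <= `|x.1|) by rewrite real_leVge.
  by move=> /max_r ->; rewrite lerDr exprn_ge0.
by move=> /max_l ->; rewrite lerDl exprn_ge0.
Qed.

Lemma prod_dot_le x : prod_dot x x <= 2 * `|x| ^+ 2.
Proof.
rewrite /prod_dot /= /Defs.prod_inner -!sqr_norm_inner prod_normE /=.
rewrite mulr_natl mulr2n.
have /orP[le|le] : (`|x.1| <= `|x.2|) || (`|x.2| <= `|x.1|).
- by rewrite real_leVge.
- by rewrite (max_r le) lerD2r lerXn2r ?nnegrE.
- by rewrite (max_l le) lerD2l lerXn2r ?nnegrE.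
Qed.

(** If [A] and [closure D] span the space, an [x] orthogonal to [D] is
    [a + b], where [b] is orthogonal to itself; the converse is the projection
    theorem. *)
Lemma is_orthogonal_sum_closureP (A D : set (H * K)) : subspace_set D ->
  is_orthogonal_sum A (closure D) setT <-> A = orthocomp prod_dot D.
Proof.
move=> sD; rewrite -(orthocomp_closure prod_dot_le); split=> [[AD sumT]|->].
  apply/seteqP; split=> [a Aa b Db|x xD]; first exact: AD.
  have : setT x by []. rewrite -sumT => -[a Aa [b Db xE]].
  have b0 : b = 0.
    apply: (@dot_eq0 _ _ _ prod_dot).
    have := xD _ Db; rewrite -xE linearDl /= => <-.
    by rewrite [X in X + _](AD _ _ Aa Db) add0r.
  by rewrite -xE b0 addr0.
split=> [a b + Db|]; first exact.
apply/seteqP; split=> // z _.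
have HKc : complete_uniform (H * K)%type.
  by apply: complete_uniform_prod; exact: completeType_complete.
have [p Dp zp] := orthogonal_projection HKc prod_dot_ge prod_dot_le z sD.
exists (z - p); first by rewrite (orthocomp_closure prod_dot_le).
by exists p => //; rewrite subrK.
Qed.

End ProdInner.

Lemma image_closure_homeo (T U : topologicalType) (g : T -> U) (h : U -> T)
    (A : set T) : continuous g -> continuous h -> cancel g h -> cancel h g ->
  g @` closure A = closure (g @` A).
Proof.
have sub (T' U' : topologicalType) (g' : T' -> U') (B : set T') :
    continuous g' -> g' @` closure B `<=` closure (g' @` B).
  move=> cg _ [x Bx <-] O Ogx; have [y [By Oy]] := Bx _ (cg x _ Ogx).
  by exists (g' y); split=> //; exists y.
move=> cg ch gK hK; apply/seteqP; split; first exact: sub.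
move=> y Ay; exists (h y) => //.
have := sub _ _ h (g @` A) ch (h y) (ex_intro2 _ _ y Ay erefl).
by rewrite image_comp (_ : h \o g = id) ?image_id //; apply/funext.
Qed.

(** * Graphs of operators and of adjoint relations *)

Section Graphs.
Variables (R : realType) (k : scalar_kind).
Local Notation F := (Defs.scalar R k).

Lemma graph_subspace (V W : lmodType F) (S : operator V W) :
  subspace_set (graph S).
Proof.
have S0 : S 0 = 0.
  have := op_linear (-1) (dom0 S) (dom0 S).
  by rewrite scaler0 addr0 scaleN1r addNr.
split=> [|a _ _ [x Sx <-] [y Sy <-]].
  by exists 0; [exact: dom0 | rewrite S0].
by exists (a *: x + y); [exact: dom_linear | rewrite op_linear].
Qed.

Lemma op_eqP (V W : lmodType F) (S1 S2 : operator V W) :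
  op_eq S1 S2 <-> graph S1 = graph S2.
Proof.
split=> [[dE vE]|gE].
  apply/seteqP; split=> _ [x Sx <-]; exists x.
  - by rewrite -dE.
  - by rewrite vE.
  - by rewrite dE.
  - by rewrite vE ?dE.
have sub (A B : operator V W) : graph A = graph B ->
    forall x, dom A x -> dom B x /\ A x = B x.
  move=> AB x Ax; have : graph A (x, A x) by exists x.
  by rewrite AB => -[y By [<- <-]].
split; last by move=> x /(sub _ _ gE)[].
apply/seteqP; split=> x; first by move=> /(sub _ _ gE)[].
by move=> /(sub _ _ (esym gE))[].
Qed.

Variables (H K : hilbertType R k).
Implicit Types (S : operator H K) (T : operator K H).

(** This is the graph of [T^*] when [T] is densely defined; in general it is
    the adjoint of [T] as a linear relation, possibly multivalued. *)
Definition adjoint_graph T : set (H * K) := [set x | adjoint_rel T x.1 x.2].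

Lemma graph_adjoint T (dT : densely_defined T) :
  graph (adjoint dT) = adjoint_graph T.
Proof.
apply/seteqP; split=> [_ [h Th <-]|[h u] Thu]; first exact: adjoint_funP.
have Th : adjoint_dom T h by exists u.
exists h => //=; congr pair.
exact: (adjoint_rel_unique dT (adjoint_funP Th) Thu).
Qed.

Definition scale2 (c : F) (x : H * K) : H * K := (x.1, c *: x.2).

Lemma scale2K c : c != 0 -> cancel (scale2 c) (scale2 c^-1).
Proof. by move=> c0 [h u]; rewrite /scale2 /= scalerA mulVf // scale1r. Qed.

Lemma closure_graph_scale (c : F) S : c != 0 ->
  closure (graph (scale_op c S)) = scale2 c @` closure (graph S).
Proof.
move=> c0.
have cont (b : F) : continuous (scale2 b).
  move=> x; apply: cvg_pair; first exact: cvg_fst.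
  by apply: cvgZr; exact: cvg_snd.
rewrite (@image_closure_homeo _ _ _ (scale2 c^-1)) //.
- by rewrite /graph image_comp.
- exact: scale2K.
- by move=> x; rewrite -{1}[c]invrK scale2K ?invr_eq0.
Qed.

Lemma flip_closure (A : set (K * H)) :
  @flip _ H K @` closure A = closure (@flip _ H K @` A).
Proof.
(* Flipping twice is taking the opposite, hence this inverse. *)
apply: (@image_closure_homeo _ _ _ (fun x => - flip x)).
- move=> x; apply: cvg_pair; first exact: cvg_snd.
  by apply: cvgN; exact: cvg_fst.
- move=> x; apply: cvgN; apply: cvg_pair; first exact: cvg_snd.
  by apply: cvgN; exact: cvg_fst.
- by case=> u h; congr pair; rewrite /= ?opprK.
- by case=> h u; congr pair; rewrite /= ?opprK.
Qed.

Lemma flip_graph_subspace T : subspace_set (@flip _ H K @` graph T).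
Proof.
have [G0 Gl] := graph_subspace T; split.
  by exists 0 => //; congr pair; rewrite /= ?oppr0.
move=> a _ _ [x Gx <-] [y Gy <-]; exists (a *: x + y); first exact: Gl.
by congr pair; rewrite /= opprD scalerN.
Qed.

(** As [c] is real, [<(h, c u), (c T x, - x)>] is [c] times the conjugate of
    [<T x, h> - <x, u>]. *)
Lemma orthocomp_flip_graph_scale T (c : F) :
  c != 0 -> scalar_conj c = c ->
  orthocomp (@prod_dot R k H K) (@flip _ H K @` graph (scale_op c T)) =
  scale2 c @` adjoint_graph T.
Proof.
move=> c0 cc.
have E h u x : prod_inner (h, c *: u) (flip (x, c *: T x)) =
    c * scalar_conj (inner (T x) h - inner x u).
  rewrite /Defs.prod_inner /= linearNr linearZr_LR linearZl_LR /= cc.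
  by rewrite [inner h _]dotC [inner u _]dotC rmorphB mulrBr.
apply/seteqP; split=> [[h u] hu|_ [[h u] Thu <-] _ [_ [x Tx <-] <-]];
    last first.
  by rewrite /prod_dot /= E (Thu _ Tx) subrr rmorph0 mulr0.
exists (h, c^-1 *: u); last by rewrite /scale2 /= scalerA mulfV // scale1r.
move=> x Tx /=; apply/eqP; rewrite -subr_eq0.
have : prod_inner (h, u) (flip (x, c *: T x)) = 0.
  by apply: hu; exists (x, c *: T x) => //; exists x.
rewrite -[u in (h, u)]scale1r -(mulfV c0) -scalerA E => /eqP.
by rewrite mulf_eq0 (negPf c0) /= fmorph_eq0.
Qed.

(** The closed graph of [c S] and the complement of the flipped graph of [c T]
    are the images under the same rescaling [scale2 c] of two sets in which [c]
    does not occur; this is why the condition does not depend on [lam]. *)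
Lemma graph_decompositionP S T (lam : R) : lam != 0 ->
  graph_decomposition S T lam <-> closure (graph S) = adjoint_graph T.
Proof.
move=> lam0; rewrite /graph_decomposition /=.
set c := scalar_of_real k (1 / lam).
have c0 : c != 0 by rewrite scalar_of_real_neq0 // div1r invr_eq0.
have cc : scalar_conj c = c by exact: scalar_conj_of_real.
rewrite flip_closure is_orthogonal_sum_closureP;
  last exact: flip_graph_subspace.
rewrite orthocomp_flip_graph_scale // closure_graph_scale //.
have inj := can_inj (scale2K c0).
by split=> [ST|-> //]; apply/funext => x; rewrite -(image_inj inj) ST image_inj.
Qed.

End Graphs.

Theorem theorem4p2 (R : realType) (k : scalar_kind) (H K : hilbertType R k)
    (S : operator H K) (T : operator K H) :
  (forall lam : R, lam != 0 -> graph_decomposition S T lam ->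
     (closable S <-> densely_defined T) /\
     (closable S \/ densely_defined T ->
        exists (cS : closable S) (dT : densely_defined T),
          op_eq (op_closure cS) (adjoint dT))) /\
  (forall (cS : closable S) (dT : densely_defined T),
     op_eq (op_closure cS) (adjoint dT) ->
     forall lam : R, lam != 0 -> graph_decomposition S T lam).
Proof.
split=> [lam lam0 /(graph_decompositionP _ _ lam0) ST|cS dT]; last first.
  move=> /op_eqP; rewrite graph_op_closure graph_adjoint => ST lam lam0.
  exact/graph_decompositionP.
have toD : closable S -> densely_defined T.
  (* If [u] is orthogonal to [dom T], then [u = B 0 = 0] because [(0, u)] is
     adjoint to [T]. *)
  move=> [B]; rewrite ST => BT; apply: subspace_dense => [|u uT].
    by split; [exact: dom0 | exact: dom_linear].
  have : graph B (0, u).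
    by rewrite BT => x Tx /=; rewrite uT // linear0.
  have : graph B 0 by case: (graph_subspace B).
  by move=> [_ _ [-> <-]] [_ _ [-> <-]].
have toC : densely_defined T -> closable S.
  by move=> dT; exists (adjoint dT); rewrite graph_adjoint ST.
split=> [|cdT]; first by split.
have dT : densely_defined T by case: cdT => // /toD.
exists (toC dT), dT; apply/op_eqP.
by rewrite graph_op_closure graph_adjoint ST.
Qed.
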